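(* Let $w:[0,T]\to\mathbb{R}^d$ be a continuous $(\gamma,\rho)$-irregular path, with $\gamma\in[0,1]$, $\rho>0$, and set $\delta^*_{\gamma,\rho}=(1-\gamma)/\rho$; assume $\delta^*_{\gamma,\rho}\in(0,1)$. Then for any $\delta>\delta^*_{\gamma,\rho}$, $w$ is nowhere $\delta$-Hölder continuous and it has infinite modulus of $\delta$-Hölder roughness; for any $p<(\delta^*_{\gamma,\rho})^{-1}$ and any (nondegenerate) interval $[s,t]\subset[0,T]$, $w$ has infinite $p$-variation on $[s,t]$.
   Context: $w$ is $(\gamma,\rho)$-irregular if there is $C$ with $\big|\int_s^te^{i\xi\cdot w_r}\,dr\big|\le C|\xi|^{-\rho}|t-s|^\gamma$ for all $\xi\in\mathbb{R}^d\setminus\{0\}$, $s,t\in[0,T]$. $w_{s,t}:=w_t-w_s$. Nowhere $\delta$-Hölder continuous: for every $s\in[0,T]$ there are no $M,r>0$ such that $|w_{s,t}|\le M|t-s|^\delta$ for all $t\in[0,T]$ with $|t-s|<r$. For $\theta\in(0,1)$, $w$ is $\theta$-Hölder rough on scale $\varepsilon_0>0$ with constant $L>0$ if for every $v\in\mathbb{S}^{d-1}$, $s\in[0,T]$ and $\varepsilon\in(0,\varepsilon_0]$ there is $t\in[0,T]$ with $|t-s|<\varepsilon$ and $|v\cdot w_{s,t}|\ge L\varepsilon^\theta$. The modulus of $\theta$-Hölder roughness is the largest such $L$; it is infinite if for every $M>0$ there exists $\varepsilon_0=\varepsilon_0(M)>0$ such that $w$ is $\theta$-Hölder rough on scale $\varepsilon_0$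 with some constant $L\ge M$. (The roughness claim refers to $\delta\in(\delta^*_{\gamma,\rho},1)$.) $p$-variation on $[s,t]$, $p>0$: $\big(\sup_\Pi\sum_i|w_{t_i,t_{i+1}}|^p\big)^{1/p}$, supremum over finite partitions $\Pi$ of $[s,t]$. *)

(* Defs.v *)
From mathcomp Require Import all_boot all_order all_algebra.
From mathcomp Require Import all_classical all_reals all_analysis.
From mathcomp Require Import complex.

Set Implicit Arguments.
Unset Strict Implicit.
Unset Printing Implicit Defensive.

Import Order.TTheory GRing.Theory Num.Theory.
Import numFieldNormedType.Exports.

Local Open Scope classical_set_scope.
Local Open Scope ring_scope.

Section Defs.
Context {R : realType}.

Definition dot d (u v : 'rV[R]_d) : R := \sum_(i < d) u 0 i * v 0 i.

(* Euclidean norm: the library's norm on 'rV[R]_d is the sup norm. *)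
Definition enorm d (u : 'rV[R]_d) : R := Num.sqrt (dot u u).

Definition expi (x : R) : R[i] := (cos x +i* sin x)%C.

(* Oriented integral, so that s and t may come in either order. *)
Definition oriented_integral (f : R -> R) (s t : R) : R :=
  if s <= t then \int[lebesgue_measure]_(r in `[s, t]) f r
  else - \int[lebesgue_measure]_(r in `[t, s]) f r.

Definition complex_integral (f : R -> R[i]) (s t : R) : R[i] :=
  (oriented_integral (fun r => complex.Re (f r)) s t
   +i* oriented_integral (fun r => complex.Im (f r)) s t)%C.

(* A path on [0, T] is a total function R -> 'rV[R]_d; its values outside
   [0, T] are irrelevant. *)

Definition incr d (w : R -> 'rV[R]_d) (s t : R) : 'rV[R]_d := w t - w s.

(* [normc] is the R-valued modulus on R[i]. *)
Definition irregular d (T gamma rho : R) (w : R -> 'rV[R]_d) : Prop :=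
  exists C : R, forall (xi : 'rV[R]_d) (s t : R),
    xi != 0 -> s \in `[0, T] -> t \in `[0, T] ->
    ComplexField.Normc.normc
      (complex_integral (fun r => expi (dot xi (w r))) s t)
    <= C * enorm xi `^ (- rho) * `|t - s| `^ gamma.

Definition nowhere_holder d (T delta : R) (w : R -> 'rV[R]_d) : Prop :=
  forall s : R, s \in `[0, T] ->
  ~ exists M r : R, [/\ 0 < M, 0 < r &
      forall t : R, t \in `[0, T] -> `|t - s| < r ->
        enorm (incr w s t) <= M * `|t - s| `^ delta].

(* eps0 and L are meant to be positive; [infinite_roughness_modulus] only uses
   it with 0 < eps0 and 0 < M <= L. *)
Definition holder_rough d (T theta eps0 L : R) (w : R -> 'rV[R]_d) : Prop :=
  forall (v : 'rV[R]_d) (s eps : R),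
    enorm v = 1 -> s \in `[0, T] -> 0 < eps <= eps0 ->
    exists t : R, [/\ t \in `[0, T], `|t - s| < eps &
      L * eps `^ theta <= `|dot v (incr w s t)|].

Definition infinite_roughness_modulus d (T theta : R) (w : R -> 'rV[R]_d)
    : Prop :=
  forall M : R, 0 < M -> exists eps0 : R, 0 < eps0 /\
    exists L : R, M <= L /\ holder_rough T theta eps0 L w.

(* For l = [:: t_1; ...; t_n] with s < t_1 < ... < t_n = t, the sum of the
   |w_{t_k, t_{k+1}}|^p, where t_0 = s. *)
Definition pvar_sum d (p : R) (w : R -> 'rV[R]_d) (s t : R) (l : seq R) : R :=
  \sum_(0 <= k < size l)
    enorm (incr w (nth t (s :: l) k) (nth t (s :: l) k.+1)) `^ p.

Definition pvariation d (p : R) (w : R -> 'rV[R]_d) (s t : R) : \bar R :=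
  (ereal_sup [set (pvar_sum p w s t l)%:E | l in itv_partition s t]
     `^ p^-1)%E.

Definition delta_star (gamma rho : R) : R := (1 - gamma) / rho.

End Defs.

(* Main.v *)
(* If |v . w_{s,r}| <= K for all r in [a, b] and some unit vector v, then at the
   frequency xi = v / K the phase xi . w_r stays within 1 of a constant, so the
   oscillatory integral over [a, b] has modulus at least cos 1 * (b - a).
   Irregularity bounds it by C K^rho (b - a)^gamma, which forces
   K >= c (b - a)^delta_star: in every direction, the path oscillates by at
   least c h^delta_star on every interval of length h.  For delta > delta_star
   this beats L h^delta for any L as soon as h is small, whence the roughness
   and a fortiori the failure of Hoelder continuity.  Cutting [s, t] into n
   equal pieces gives a p-variation sum of order n^(1 - delta_star * p), which
   is unbounded when p < 1 / delta_star. *)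

Require Import Defs.
From mathcomp Require Import all_boot all_order all_algebra.
From mathcomp Require Import all_classical all_reals all_analysis.
From mathcomp Require Import complex ring lra.

Import Order.TTheory GRing.Theory Num.Theory.
Import numFieldNormedType.Exports.

Local Open Scope classical_set_scope.
Local Open Scope ring_scope.

(** * Euclidean inner product and norm *)

Lemma dotBr {R : realType} {d} (v a b : 'rV[R]_d) :
  dot v (a - b) = dot v a - dot v b.
Proof.
by rewrite /dot -sumrB; apply: eq_bigr => i _; rewrite !mxE mulrBr.
Qed.

Lemma dotZl {R : realType} {d} (l : R) (u v : 'rV[R]_d) :
  dot (l *: u) v = l * dot u v.
Proof.
by rewrite /dot mulr_sumr; apply: eq_bigr => i _; rewrite mxE mulrA.
Qed.

Lemma dotC {R : realType} {d} (u v : 'rV[R]_d) : dot u v = dot v u.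
Proof. by apply: eq_bigr => i _; rewrite mulrC. Qed.

Lemma dot_ge0 {R : realType} {d} (u : 'rV[R]_d) : 0 <= dot u u.
Proof. by apply: sumr_ge0 => i _; rewrite -expr2 sqr_ge0. Qed.

Lemma enormZ {R : realType} {d} (l : R) (u : 'rV[R]_d) :
  enorm (l *: u) = `|l| * enorm u.
Proof.
by rewrite /enorm dotZl dotC dotZl mulrA -expr2 sqrtrM ?sqr_ge0// sqrtr_sqr.
Qed.

Lemma enorm_delta {R : realType} {d} (i : 'I_d) :
  enorm (delta_mx 0 i : 'rV[R]_d) = 1.
Proof.
rewrite /enorm /dot (bigD1 i)//= big1 => [|j /negPf ji].
  by rewrite !mxE !eqxx mulr1 addr0 sqrtr1.
by rewrite !mxE ji mulr0.
Qed.

(** Cauchy-Schwarz: the part of [u] orthogonal to [v] has squared norm |u|^2 - (v . u)^2, which is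
    nonnegative. *)
Lemma dot_le_enorm {R : realType} {d} (v u : 'rV[R]_d) :
  enorm v = 1 -> `|dot v u| <= enorm u.
Proof.
move=> v1; have dv1 : dot v v = 1.
  by rewrite -(sqr_sqrtr (dot_ge0 v)) -/(enorm v) v1 expr1n.
rewrite -sqrtr_sqr ler_wsqrtr//.
have := dot_ge0 (u - dot v u *: v).
rewrite dotBr (dotC _ u) (dotC _ (_ *: v)) dotZl !dotBr.
by rewrite (dotC u (_ *: v)) (dotC v (_ *: v)) !dotZl dv1 mulr1 subrr mulr0 subr0
  subr_ge0 expr2.
Qed.

(** * Lower bound for an oscillatory integral *)

Lemma cos1_le_cos {R : realType} (x : R) : `|x| <= 1 -> cos 1 <= cos x.
Proof.
move=> x1; have pi1 : (1 : R) <= pi by rewrite (le_trans _ (pi_ge2 R)) ?ler1n.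
rewrite -(cos_norm x) leNgt ltr_cos ?in_itv/= ?normr_ge0 ?ler01//=.
  by rewrite -leNgt.
exact: le_trans x1 pi1.
Qed.

Lemma within_continuous_dot {R : realType} {d} (A : set R)
    (w : R -> 'rV[R]_d) v :
  {within A, continuous w} -> {within A, continuous (fun r => dot v (w r))}.
Proof.
apply: (@within_continuous_comp _ _ _ A w (dot v)) => x _.
apply: continuous_big => [|i _]; first exact: add_continuous.
move=> y; apply: (@cvgMl_tmp _ _ (nbhs y)); exact: coord_continuous.
Qed.

(* Rotating the exponential by the phase [c] makes its real part at least
   [cos 1] on the whole interval. *)
Lemma cos1_le_complex_integral {R : realType} (x : R -> R) (c a b : R) :
  a < b -> {within `[a, b], continuous x} ->
  (forall r, a <= r <= b -> `|x r - c| <= 1) ->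
  cos 1 * (b - a) <=
  ComplexField.Normc.normc (complex_integral (fun r => expi (x r)) a b).
Proof.
move=> ab cx xc1.
have intg (g : R -> R) : continuous g ->
    lebesgue_measure.-integrable `[a, b] (EFin \o (fun r => g (x r))).
  move=> cg; apply: continuous_compact_integrable; first exact: segment_compact.
  exact: (@within_continuous_comp _ _ _ `[a, b] x g).
have intC := intg _ (@continuous_cos R); have intS := intg _ (@continuous_sin R).
have cZ k (g : R -> R) : continuous g -> continuous (fun y : R => k * g y).
  by move=> cg y; apply: cvgMl_tmp; exact: cg.
have intCZ := intg _ (cZ (cos c) _ (@continuous_cos R)).
have intSZ := intg _ (cZ (sin c) _ (@continuous_sin R)).
have intK := intg (fun=> cos 1) (@cst_continuous _ _ _).
rewrite /complex_integral /oriented_integral /= (ltW ab).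
set A := Rintegral _ _ _; set B := Rintegral _ _ _.
(* The right-hand side is the real part of exp(-ic) (A + iB), that is, the integral of cos (x r -
   c). *)
have le1 : cos 1 * (b - a) <= cos c * A + sin c * B.
  have <- : \int[lebesgue_measure]_(r in `[a, b])
      (cos c * cos (x r) + sin c * sin (x r)) = cos c * A + sin c * B :> R.
    by rewrite RintegralD// !RintegralZl.
  have -> : cos 1 * (b - a) = \int[lebesgue_measure]_(r in `[a, b]) cos 1 :> R.
    by rewrite Rintegral_cst// [X in fine X]lebesgue_measure_itv/= lte_fin ab.
  rewrite le_Rintegral//.
    apply: (intg (fun y => cos c * cos y + sin c * sin y)) => y.
    by apply: cvgD; apply: cZ; [exact: continuous_cos | exact: continuous_sin].
  move=> r /=; rewrite in_itv/= => /xc1 /cos1_le_cos.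
  by rewrite cosB [cos c * _]mulrC [sin c * _]mulrC.
apply: le_trans le1 _; apply: le_trans (ler_norm _) _.
rewrite -sqrtr_sqr ler_wsqrtr// -subr_ge0.
(* Lagrange's identity, with cos^2 c + sin^2 c = 1 inserted as a factor of A^2 + B^2. *)
rewrite (_ : _ - _ = (sin c * A - cos c * B) ^+ 2) ?sqr_ge0//.
have := cos2Dsin2 c; set C := cos c; set S := sin c => CS.
rewrite -[A ^+ 2 + _]mul1r -CS; ring.
Qed.

(** * From irregularity to oscillation in every direction *)

(** The base point [s] is independent of [a, b], since moving it only shifts the phase by a
    constant; this allows intervals on either side of [s]. Quantifying over upper bounds [K] avoids
    a supremum. *)
Definition oscillates {R : realType} {d} (T theta c : R) (w : R -> 'rV[R]_d)
    : Prop :=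
  forall (v : 'rV[R]_d) (s a b K : R), enorm v = 1 ->
    0 <= a -> a < b -> b <= T -> 0 < K ->
    (forall r, a <= r <= b -> `|dot v (incr w s r)| <= K) ->
    c * (b - a) `^ theta <= K.

Lemma irregular_osc {R : realType} {d} (T gamma rho : R) (w : R -> 'rV[R]_d) :
  0 < rho -> {within `[0, T], continuous w} -> irregular T gamma rho w ->
  exists2 c, 0 < c & oscillates T (delta_star gamma rho) c w.
Proof.
move=> rho0 cw [C irr].
(* [C] might be nonpositive, whereas the division below needs a positive constant. *)
set C' := `|C| + 1; have C'0 : 0 < C' by rewrite ltr_wpDl.
have c1 := cos1_gt0 R.
(* Comes from solving cos 1 h <= C' K^rho h^gamma for K, where h = b - a. *)
exists ((cos 1 / C') `^ rho^-1); first by rewrite powR_gt0// divr_gt0.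
move=> v s a b K v1 a0 ab bT K0 wK.
have h0 : 0 < b - a by rewrite subr_gt0.
have nxi : enorm (K^-1 *: v) = K^-1.
  by rewrite enormZ v1 mulr1 ger0_norm// invr_ge0 ltW.
have xi0 : K^-1 *: v != 0.
  apply: contraTN isT => /eqP xi0; move: nxi; rewrite xi0.
  rewrite -(scale0r v) enormZ normr0 mul0r => /esym/eqP.
  by rewrite invr_eq0 gt_eqF.
have aT : a \in `[0, T] by rewrite in_itv/= a0 (le_trans (ltW ab)).
have bT' : b \in `[0, T] by rewrite in_itv/= bT (le_trans a0 (ltW ab)).
have := irr _ _ _ xi0 aT bT'.
rewrite nxi ger0_norm ?(ltW h0)//; set rhs := C * _ * _ => le_irr.
have {le_irr} le_rhs : cos 1 * (b - a) <= rhs.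
  apply: le_trans le_irr; apply: (cos1_le_complex_integral
    (fun r => dot (K^-1 *: v) (w r)) (dot (K^-1 *: v) (w s))) => //.
    apply: within_continuous_dot; apply: continuous_subspaceW cw => r /=.
    by rewrite !in_itv/= => /andP[ar rb]; rewrite (le_trans a0)//= (le_trans rb).
  move=> r /wK wr; rewrite -dotBr dotZl normrM ger0_norm ?invr_ge0 ?(ltW K0)//.
  by rewrite mulrC ler_pdivrMr// mul1r.
have rhsE : rhs <= C' * K `^ rho * (b - a) `^ gamma.
  rewrite /rhs -(powR_inv1 (ltW K0)) -powRrM mulN1r opprK.
  rewrite ler_wpM2r ?powR_ge0// ler_wpM2r ?powR_ge0// (le_trans (ler_norm C))//.
  by rewrite /C' lerDl.
have {rhsE} := le_trans le_rhs rhsE.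
have hE : b - a = (b - a) `^ (1 - gamma) * (b - a) `^ gamma.
  by rewrite -powRD ?subrK ?powRr1 ?(ltW h0)// (gt_eqF h0) implybT.
rewrite {1}hE mulrA ler_pM2r ?powR_gt0//.
rewrite [X in _ <= X]mulrC -ler_pdivrMr// mulrAC => key.
have rV0 : 0 <= rho^-1 by rewrite invr_ge0 ltW.
have := ge0_ler_powR rV0 _ _ key.
have hge0 : 0 <= cos 1 / C' by rewrite divr_ge0// ltW.
rewrite !nnegrE (powRM _ hge0) ?powR_ge0// -!powRrM divff ?gt_eqF//.
rewrite powRr1 ?(ltW K0)//; apply => //.
by rewrite mulr_ge0// powR_ge0.
Qed.

(** * Roughness and failure of Hölder continuity *)

Lemma osc_infinite_roughness {R : realType} {d} (T theta delta : R)
    (w : R -> 'rV[R]_d) (c : R) :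
  0 < T -> 0 < c -> theta < delta -> oscillates T theta c w ->
  infinite_roughness_modulus T delta w.
Proof.
move=> T0 c0 td osc M M0.
have q0 : 0 < delta - theta by rewrite subr_gt0.
set k := c * 2^-1 `^ theta.
have k0 : 0 < k by rewrite mulr_gt0// powR_gt0.
have B0 : 0 < k / (2 * M) by rewrite divr_gt0// mulr_gt0.
(* The bound by [T] leaves room for an interval of length eps / 2 beside [s]; the other bound gives
   M eps^delta <= (k / 2) eps^theta, strictly below k eps^theta = c (eps / 2)^theta. *)
exists (Num.min T ((k / (2 * M)) `^ (delta - theta)^-1)); split.
  by rewrite lt_min T0 powR_gt0.
exists M; split=> // v s eps v1; rewrite in_itv/= => /andP[s0 sT].
rewrite le_min => /and3P[e0 eT eB].
apply: contrapT => no_t.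
have wlt t : 0 <= t <= T -> `|t - s| < eps ->
    `|dot v (incr w s t)| <= M * eps `^ delta.
  move=> tT ts; rewrite leNgt; apply/negP => /ltW lt_w.
  by apply: no_t; exists t; split; rewrite ?in_itv.
(* The interval starts at [s] if it fits before [T], and otherwise ends at [s]. Half the length
   keeps |r - s| < eps strict. *)
have [a [a0 aT sub]] : exists a, [/\ 0 <= a, a + eps / 2 <= T &
    forall r, a <= r <= a + eps / 2 -> `|r - s| < eps].
  have [seT|seT] := leP (s + eps / 2) T.
    by exists s; split=> // r /andP[? ?]; rewrite ltr_norml; lra.
  exists (s - eps / 2); split; [lra|lra|].
  by move=> r /andP[? ?]; rewrite ltr_norml; lra.
have := osc v s a (a + eps / 2) (M * eps `^ delta) v1 a0.
rewrite ltrDl divr_gt0// aT mulr_gt0 ?powR_gt0// addrAC subrr add0r.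
move=> /(_ isT isT isT) osc_eps.
have {osc_eps} : c * (eps / 2) `^ theta <= M * eps `^ delta.
  by apply: osc_eps => r ar; apply: wlt; [lra|exact: sub].
apply/negP; rewrite -ltNge.
rewrite -(subrK theta delta) powRD ?(gt_eqF e0) ?implybT//.
rewrite powRM ?(ltW e0)// mulrA [ltRHS]mulrCA [ltRHS]mulrC ltr_pM2r ?powR_gt0//.
have := ge0_ler_powR (ltW q0) _ _ eB.
rewrite !nnegrE (ltW e0) powR_ge0 -powRrM mulVf ?gt_eqF// powRr1 ?(ltW B0)//.
move=> /(_ isT isT) epsB; rewrite -/k.
apply: (@le_lt_trans _ _ (M * (k / (2 * M)))); first by rewrite ler_pM2l.
have -> : M * (k / (2 * M)) = k / 2 by field; rewrite gt_eqF.
by rewrite ltr_pdivrMr// ltr_pMr// ltr1n.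
Qed.

Lemma infinite_roughness_nowhere_holder {R : realType} {d} (T delta : R)
    (w : R -> 'rV[R]_d) :
  (0 < d)%N -> 0 <= delta ->
  infinite_roughness_modulus T delta w -> nowhere_holder T delta w.
Proof.
move=> d0 delta0 rough s sT [M [r [M0 r0 wM]]].
(* A roughness constant above [M], used at a scale at most [r], contradicts the Hölder bound at
   [s]. *)
have [eps0 [eps00 [L [ML wL]]]] := rough (M + 1) (addr_gt0 M0 ltr01).
set eps := Num.min eps0 r; have e0 : 0 < eps by rewrite lt_min eps00.
have v1 := enorm_delta (R := R) (Ordinal d0).
have [|t [tT tse wLt]] := wL _ s eps v1 sT.
  by rewrite e0 ge_min lexx.
have := wM t tT (lt_le_trans tse _); rewrite ge_min lexx orbT => /(_ isT) wMt.
have := le_trans (le_trans wLt (dot_le_enorm _ _ v1)) wMt.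
have /(ler_wpM2l (ltW M0)) : `|t - s| `^ delta <= eps `^ delta.
  by rewrite ge0_ler_powR ?nnegrE// ltW.
move=> h1 /le_trans /(_ h1); rewrite ler_pM2r ?powR_gt0//; lra.
Qed.

(** * Infinite p-variation *)

Lemma pvar_sum_cons {R : realType} {d} (p : R) (w : R -> 'rV[R]_d) s t x l :
  pvar_sum p w s t (x :: l) = enorm (incr w s x) `^ p + pvar_sum p w x t l.
Proof. by rewrite /pvar_sum /= big_nat_recl. Qed.

(** Induction over the cells of length [h]: each contributes a point [r] carrying a large increment,
    and its right end, where the next cell starts. *)
Lemma pvar_sum_equipartition {R : realType} {d} (p q h t : R)
    (w : R -> 'rV[R]_d) n s :
  0 < h -> s + n%:R * h = t ->
  (forall a, s <= a -> a + h <= t ->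
    exists2 r, a < r <= a + h & q <= enorm (incr w a r) `^ p) ->
  exists2 l, itv_partition s t l & n%:R * q <= pvar_sum p w s t l.
Proof.
move=> h0; elim: n s => [|n IHn] s sn large.
  exists [::]; last by rewrite mul0r /pvar_sum big_nil.
  by rewrite /itv_partition/= -sn mul0r addr0.
have sn' : s + h + n%:R * h = t by rewrite -sn -natr1; ring.
have nh0 : 0 <= n%:R * h by rewrite mulr_ge0// ltW.
have [r /andP[sr]] : exists2 r, s < r <= s + h & q <= enorm (incr w s r) `^ p.
  by apply: large => //; lra.
have [|l [pl ll] ql] := IHn _ sn'.
  by move=> a sa; apply: large; lra.
(* Partition points must strictly increase, so [r] and [s + h] are both listed only when they
   differ; the extra term is then nonnegative. *)
rewrite le_eqVlt => /predU1P[->|rh] qr.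
  exists (s + h :: l); first by split=> //=; rewrite ltrDl h0.
  by rewrite pvar_sum_cons -natr1 mulrDl mul1r addrC lerD// -rsh.
exists [:: r, s + h & l]; first by split=> //=; rewrite sr rh.
rewrite !pvar_sum_cons -natr1 mulrDl mul1r addrC lerD//.
by rewrite (le_trans ql)// lerDr powR_ge0.
Qed.

Lemma osc_pvariation {R : realType} {d} (T theta p : R) (w : R -> 'rV[R]_d)
    (c : R) :
  (0 < d)%N -> 0 < c -> 0 < p -> theta * p < 1 -> oscillates T theta c w ->
  forall s t, 0 <= s -> s < t -> t <= T -> pvariation p w s t = +oo%E.
Proof.
move=> d0 c0 p0 tp1 osc s t s0 st tT.
apply: eqy_poweR; first by rewrite invr_gt0.
rewrite -(image_comp (pvar_sum p w s t) EFin).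
apply: hasNub_ereal_sup; last first.
  exists (pvar_sum p w s t [:: t]), [:: t] => //.
  by split=> //=; rewrite st.
move=> [A ubA].
have ts0 : 0 < t - s by rewrite subr_gt0.
have e0 : 0 < 1 - theta * p by rewrite subr_gt0.
set e := 1 - theta * p in e0 *.
set D := (c / 2) `^ p * (t - s) `^ (theta * p).
have D0 : 0 < D by rewrite mulr_gt0// powR_gt0// divr_gt0.
(* The sum will be at least n K^p = D n^e, and n > X makes this exceed |A|, for a supposed upper
   bound [A]. *)
set X := (`|A| / D) `^ e^-1; set n := (Num.truncn X).+1.
have n0 : 0 < n%:R :> R by rewrite ltr0n.
set h := (t - s) / n%:R; have h0 : 0 < h by rewrite divr_gt0.
(* Half the guaranteed oscillation, so that [K] cannot bound the increments on a whole cell. *)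
set K := c / 2 * h `^ theta.
have K0 : 0 < K by rewrite mulr_gt0 ?powR_gt0// divr_gt0.
have nh : s + n%:R * h = t by rewrite mulrC divfK ?gt_eqF// addrC subrK.
have v1 := enorm_delta (R := R) (Ordinal d0).
have [|l lP] := pvar_sum_equipartition p (K `^ p) h t w n s h0 nh.
  move=> a sa ah; set v := delta_mx 0 (Ordinal d0) in v1.
  have [r rah Kr] : exists2 r, a <= r <= a + h & K < `|dot v (incr w a r)|.
    apply: contrapT => small.
    have := osc v a a (a + h) K v1 (le_trans s0 sa).
    rewrite ltrDl h0 (le_trans ah tT) K0 addrAC subrr add0r.
    move=> /(_ isT isT isT) osc_h.
    have {osc_h} : c * h `^ theta <= K.
      apply: osc_h => r ar; rewrite leNgt; apply/negP => Kr.
      by apply: small; exists r.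
    apply/negP; rewrite -ltNge /K ltr_pM2r ?powR_gt0//; lra.
  exists r.
    case/andP: rah => ar ->; rewrite andbT lt_neqAle ar andbT.
    (* The increment from [a] to itself vanishes, so [r] differs from [a]. *)
    apply: contraTneq Kr => <-.
    by rewrite /incr dotBr subrr normr0 -leNgt ltW.
  rewrite ge0_ler_powR ?nnegrE ?(ltW K0) ?(ltW p0) ?sqrtr_ge0//.
  exact: le_trans (ltW Kr) (dot_le_enorm _ _ v1).
apply/negP; rewrite -ltNge; apply: (@le_lt_trans _ _ A).
  by apply: ubA; exists l.
apply: (le_lt_trans (ler_norm A)).
have -> : n%:R * K `^ p = D * n%:R `^ e.
  rewrite /K /h /D /e powRM ?powR_ge0 ?divr_ge0 ?(ltW c0)// -powRrM.
  rewrite [((t - s) / _) `^ _]powRM ?invr_ge0 ?(ltW ts0)//.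
  rewrite -(powR_inv1 (ltW n0)) -powRrM mulN1r.
  rewrite powRD ?(gt_eqF n0) ?implybT// powRr1//; ring.
rewrite mulrC -ltr_pdivrMr//.
have X0 : 0 <= `|A| / D by rewrite divr_ge0// ltW.
have : X `^ e < n%:R `^ e.
  by apply: gt0_ltr_powR; rewrite ?nnegrE ?powR_ge0// truncnS_gt.
by rewrite -powRrM mulVf ?gt_eqF// powRr1.
Qed.

Theorem theorem36 (R : realType) (d : nat) (T gamma rho : R)
    (w : R -> 'rV[R]_d)
    (d_gt0 : (0 < d)%N) (T_gt0 : 0 < T)
    (gamma01 : 0 <= gamma <= 1) (rho_gt0 : 0 < rho)
    (w_cont : {within `[0, T], continuous w})
    (w_irr : irregular T gamma rho w)
    (delta_star01 : 0 < delta_star gamma rho < 1) :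
  (forall delta : R, delta_star gamma rho < delta ->
     nowhere_holder T delta w /\
     (delta < 1 -> infinite_roughness_modulus T delta w)) /\
  (forall p : R, 0 < p -> p < (delta_star gamma rho)^-1 ->
     forall s t : R, 0 <= s -> s < t -> t <= T ->
       pvariation p w s t = +oo%E).
Proof.
have [c c0 osc] := irregular_osc T gamma rho w rho_gt0 w_cont w_irr.
case/andP: delta_star01 => ds0 _; split=> [delta ds_lt|p p0 p_lt].
  have rough := osc_infinite_roughness T _ delta w c T_gt0 c0 ds_lt osc.
  split=> //; apply: infinite_roughness_nowhere_holder rough => //.
  exact: ltW (lt_trans ds0 ds_lt).
apply: osc_pvariation c0 p0 _ osc => //.
by rewrite mulrC -ltr_pdivlMr// div1r.
Qed.
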